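(* Let $X$ be a Fréchet space over $\mathbb{K}=\mathbb{R}$ or $\mathbb{C}$, and let $\mathcal{X}=(x_{n,k})_{n\geq k\geq 0}$ be a family of elements of $X$ such that for every $k\geq 0$ the sequence $(x_{n,k})_{n\geq k}$ is convergent in $X$. Let $\mu=(\mu_n)_n\subset\mathbb{N}$ be an increasing sequence. The following assertions are equivalent. (1) $\mathcal{U}^{\mu}(\mathcal{X})\cap\mathbb{K}^{\mathbb{N}}\neq\emptyset$; (2) For all $K\geq 0$, $\displaystyle\bigcup_{n\in\mu}\mathrm{span}(x_{n,k},\,K\leq k\leq n)$ is dense in $X$; (3) For all $N\geq K\geq 0$, $\displaystyle\bigcup_{n\geq N,\ n\in\mu}\mathrm{span}(x_{n,k},\,K\leq k\leq n)$ is dense in $X$.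
   Context: $\mathbb{N}=\{0,1,2,\dots\}$ and ''increasing'' for index sequences means strictly increasing; such a sequence $\mu=(\mu_n)_n$ is identified with the set of its values. For $a=(a_k)_{k\ge 0}\in\mathbb{K}^{\mathbb{N}}$ set $S_n^{\mathcal{X}}(a)=\sum_{k=0}^n a_k x_{n,k}$. $\mathcal{U}^{\mu}(\mathcal{X})\cap\mathbb{K}^{\mathbb{N}}$ is the set of all $a\in\mathbb{K}^{\mathbb{N}}$ such that $\{S_{\mu_n}^{\mathcal{X}}(a):\ n\geq 0\}$ is dense in $X$. The span of an empty family is $\{0\}$. *)

(* Defs.v *)
From mathcomp Require Import all_boot all_order all_algebra.
From mathcomp Require Import all_classical all_reals all_analysis.
From mathcomp Require Import complex.

Set Implicit Arguments.
Unset Strict Implicit.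
Unset Printing Implicit Defensive.

Import Order.TTheory GRing.Theory Num.Theory.
Import numFieldNormedType.Exports.

Local Open Scope classical_set_scope.
Local Open Scope ring_scope.

Variant real_or_complex (R : realType) : numFieldType -> Prop :=
| RealScalars : real_or_complex R R
| ComplexScalars : real_or_complex R (R[i])%C.

Record complete_invariant_metric (R : realType) (K : numFieldType)
    (X : tvsType K) (d : X -> X -> R) : Prop := {
  cim_eq0 : forall x y, d x y = 0 <-> x = y ;
  cim_sym : forall x y, d x y = d y x ;
  cim_triangle : forall x y z, d x z <= d x y + d y z ;
  cim_invariant : forall x y z, d (x + z) (y + z) = d x y ;
  cim_nbhs : forall (x : X) (A : set X),
    nbhs x A <-> exists2 e : R, 0 < e & [set y | d x y < e] `<=` A ;
  cim_complete : forall u : nat -> X,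
    (forall e : R, 0 < e -> exists N : nat, forall m n : nat,
       (N <= m)%N -> (N <= n)%N -> d (u m) (u n) < e) ->
    exists l : X, u n @[n --> \oo] --> l }.

(* A [tvsType] is locally convex, but neither Hausdorff nor complete in general,
   and its uniformity, which is only required to be compatible with the topology,
   need not be translation-invariant.  Completeness is therefore expressed with
   an invariant metric rather than with [completeType]. *)
Definition frechet_space (R : realType) (K : numFieldType) (X : tvsType K) :=
  exists d : X -> X -> R, complete_invariant_metric d.

(* An array (x_{n,k})_{n >= k >= 0} is a total function [x : nat -> nat -> X],
   of which only the values [x n k] with [k <= n] are used. *)
Definition partial_sum (K : numFieldType) (X : tvsType K)
    (x : nat -> nat -> X) (a : nat -> K) (n : nat) : X :=
  \sum_(0 <= k < n.+1) a k *: x n k.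

Definition universal (K : numFieldType) (X : tvsType K)
    (mu : nat -> nat) (x : nat -> nat -> X) : set (nat -> K) :=
  [set a | dense (range (fun n => partial_sum x a (mu n)))].

Definition span_between (K : numFieldType) (X : tvsType K)
    (v : nat -> X) (m n : nat) : set X :=
  [set y | exists c : nat -> K, y = \sum_(m <= k < n.+1) c k *: v k].

(* Main.v *)
(** For (1) => (2), a dense sequence in a space without isolated points keeps
    visiting every ball, and the first [k0] terms of the partial sums converge,
    so they can be absorbed by a translation.  For (2) => (3), (2) at rank [n0]
    suffices, since the spans with [n < n0] are then [{0}].  For (3) => (1), the
    spans make [X] separable; the sequence [a] is built by consecutive blocks,
    the block added at stage [j] bringing one partial sum close to the [j]-th
    target, after correction by the limit of the part already chosen. *)
Require Import Defs.
From mathcomp Require Import all_boot all_order all_algebra.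
From mathcomp Require Import all_classical all_reals all_analysis.
From mathcomp Require Import complex.
Import Order.TTheory GRing.Theory Num.Theory.
Import numFieldNormedType.Exports.
Local Open Scope classical_set_scope.
Local Open Scope ring_scope.

(** * Separability of the scalars, and gluing of finite prefixes *)

Lemma dense_sequence_real (R : realType) :
  exists q : nat -> R, forall (z e : R), 0 < e -> exists n, `|z - q n| < e.
Proof.
exists (fun n => ratr (odflt 0 (unpickle n))) => z e e0.
have [|r] := @rat_in_itvoo R (z - e) (z + e); first by rewrite ltrD2l gtrN.
rewrite in_itv/= => zr.
by exists (pickle r); rewrite pickleK/= ltr_distlC.
Qed.

Lemma dense_sequence_complex (R : realType) :
  exists q : nat -> R[i]%C,
    forall z e : R[i]%C, 0 < e -> exists n, `|z - q n| < e.
Proof.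
have [q qP] := dense_sequence_real R.
pose Q (p : nat * nat) : R[i]%C := (q p.1)%:C%C + 'i%C * (q p.2)%:C%C.
exists (fun n => Q (odflt (0, 0)%N (unpickle n))) => -[a b] [r s].
(* In the order of [R[i]], [0 < e] forces the imaginary part of [e] to vanish, so the radius is the
   real number [r]. *)
rewrite ltcE/= => /andP[/eqP -> r0].
have [m mP] := qP a (r / 2) (divr_gt0 r0 (ltr0n _ 2)).
have [n nP] := qP b (r / 2) (divr_gt0 r0 (ltr0n _ 2)).
exists (pickle (m, n)); rewrite pickleK/=.
have -> : (a +i* b)%C - Q (m, n) =
    (a - q m)%:C%C + 'i%C * (b - q n)%:C%C :> R[i]%C.
  apply/eqP; rewrite eq_complex/=.
  by rewrite !(mul0r, mul1r, mulr0, addr0, add0r, subr0, oppr0) !eqxx.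
apply: (le_lt_trans (ler_normD _ _)).
have normR (t : R) : `|t%:C%C| = `|t|%:C%C.
  by rewrite normc_def/= expr0n/= addr0 sqrtr_sqr.
have normi : `|'i%C : R[i]%C| = 1.
  by rewrite normc_def/= expr0n expr1n/= add0r sqrtr1.
rewrite normrM normi mul1r !normR -rmorphD/= -[X in _ < X]/(r%:C%C) ltcR.
by rewrite [r]splitr ltrD.
Qed.

Lemma scalars_separable (R : realType) (K : numFieldType) :
  real_or_complex R K ->
  exists q : nat -> K, forall z e : K, 0 < e -> exists n, `|z - q n| < e.
Proof.
by case; [exact: dense_sequence_real|exact: dense_sequence_complex].
Qed.

(* The property [Q j] is secured by a finite prefix, which later stages keep. *)
Lemma prefix_glue (T : Type) (t0 : T) (Q : nat -> (nat -> T) -> Prop) :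
  (forall j k (a : nat -> T), exists a' k',
     [/\ (k < k')%N, forall i, (i < k)%N -> a' i = a i &
       forall b, (forall i, (i < k')%N -> b i = a' i) -> Q j b]) ->
  exists a, forall j, Q j a.
Proof.
move=> step.
have /choice[f fP] : forall s : nat * nat * (nat -> T),
    exists t : nat * (nat -> T),
     [/\ (s.1.2 < t.1)%N, forall i, (i < s.1.2)%N -> t.2 i = s.2 i &
       forall b, (forall i, (i < t.1)%N -> b i = t.2 i) -> Q s.1.1 b].
  move=> [[j k] a]; have [a' [k' H]] := step j k a; by exists (k', a').
(* A state is a prefix length together with a sequence whose values below that length are final. *)
pose st := fix st j := if j is j'.+1 then f (j', (st j').1, (st j').2)
                       else (0%N, fun=> t0).
have stP j := fP (j, (st j).1, (st j).2).
have st_ge j : (j <= (st j).1)%N.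
  elim: j => // j IH; apply: leq_ltn_trans IH _.
  by have [/= lt _ _] := stP j.
have agree j m i : (i < (st j).1)%N ->
    (i < (st (j + m)).1)%N /\ (st (j + m)%N).2 i = (st j).2 i.
  move=> ij; elim: m => [|m [IH1 IH2]]; first by rewrite addn0.
  rewrite addnS; have [/= lt eqs _] := stP (j + m)%N.
  by split; [exact: ltn_trans IH1 lt|rewrite eqs].
(* Diagonal choice: the prefix at stage [i.+1] has length at least [i.+1], so entry [i] is already
   final there. *)
exists (fun i => (st i.+1).2 i) => j.
have [_ _] := stP j; apply => i /= ilt.
(* Stages [i.+1] and [j.+1] are compared through the common later stage [i.+1 + j]. *)
have [_ <-] := agree i.+1 j i (st_ge i.+1).
by have [_ <-] := agree j.+1 i i ilt; rewrite addSn -addnS addnC.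
Qed.

(** * Density and approximation under an invariant metric *)

Section InvariantMetric.
Context {R : realType} {K : numFieldType} {X : tvsType K} {d : X -> X -> R}.
Context (dP : complete_invariant_metric d).

Lemma cim_xx x : d x x = 0.
Proof. exact/(cim_eq0 dP). Qed.

Lemma cim_ge0 x y : 0 <= d x y.
Proof.
have := cim_triangle dP x y x; rewrite cim_xx (cim_sym dP y x).
by rewrite -mulr2n pmulrn_lge0.
Qed.

Lemma cim_gt0 x y : x <> y -> 0 < d x y.
Proof.
by move=> xy; rewrite lt_neqAle cim_ge0 andbT eq_sym; apply/eqP => /(cim_eq0 dP).
Qed.

Lemma cim_add a b a' b' : d (a + b) (a' + b') <= d a a' + d b b'.
Proof.
apply: le_trans (cim_triangle dP _ (a' + b) _) _.
by rewrite (cim_invariant dP) ![a' + _]addrC (cim_invariant dP).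
Qed.

Lemma cim_add_lt a b a' b' e :
  d a a' < e / 2 -> d b b' < e / 2 -> d (a + b) (a' + b') < e.
Proof.
by move=> ? ?; apply: le_lt_trans (cim_add _ _ _ _) _; rewrite [e]splitr ltrD.
Qed.

Lemma nbhs_cim x e : 0 < e -> nbhs x [set y | d x y < e].
Proof. by move=> e0; apply/(cim_nbhs dP); exists e. Qed.

Lemma dense_cim (A : set X) :
  dense A <-> forall y e, 0 < e -> exists2 z, A z & d y z < e.
Proof.
split=> [dA y e e0|H O [y Oy] oO].
  have [|z [/interior_subset/= zy Az]] := dA _ _ (open_interior [set z | d y z < e]).
    by exists y; exact: nbhs_cim.
  by exists z.
have /(cim_nbhs dP)[e e0 eO] : nbhs y O by exact: open_nbhs_nbhs.
by have [z Az yz] := H y e e0; exists z; split => //; apply: eO.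
Qed.

Lemma cvg_cim (u : nat -> X) l e : u @ \oo --> l -> 0 < e ->
  exists N, forall n, (N <= n)%N -> d l (u n) < e.
Proof. by move=> ul e0; have [N _ H] := ul _ (nbhs_cim l e e0); exists N. Qed.

(** Links the two scales of smallness: [r] is measured by the norm of [K], possibly complex, and [e]
    by the real-valued [d]. *)
Lemma scale_continuous_cim (v : X) (z : K) (e : R) : 0 < e ->
  exists2 r : K, 0 < r & forall w, `|z - w| < r -> d (z *: v) (w *: v) < e.
Proof.
move=> e0.
have c : (fun w : K^o => w *: v) @ (z : K^o) --> z *: v.
  apply: (@cvg_comp _ _ _ (fun w : K^o => (w, v))
    (fun p => p.1 *: p.2)); last first.
    exact: (@scale_continuous K X (z, v)).
  apply: (@cvg_pair _ _ _ (nbhs (z : K^o)) (nbhs (z : K^o)) (nbhs v)).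
    exact: cvg_id.
  exact: cvg_cst.
have /nbhs_ballP[r /= r0 H] := c _ (nbhs_cim (z *: v) e e0).
by exists r => // w zw; apply: H.
Qed.

(** A nonzero [v] rules out isolated points: if [y] is [p] itself, it is shifted by a small nonzero
    multiple of [v]. *)
Lemma cim_near_distinct (v y p : X) (e : R) : v <> 0 -> 0 < e ->
  exists2 y', y' <> p & d y y' < e.
Proof.
move=> v0 e0; have [->|yp] := eqVneq y p; last first.
  by exists y; [exact/eqP|rewrite cim_xx].
have [r r0 rP] := scale_continuous_cim v 0 e e0.
have r2 : 0 < r / 2 by rewrite divr_gt0.
exists ((r / 2) *: v + p).
  move/eqP; rewrite -subr_eq0 addrK scaler_eq0 gt_eqF//= => /eqP; exact: v0.
rewrite -[X in d X _]add0r (cim_invariant dP) -(scale0r v); apply: rP.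
by rewrite sub0r normrN gtr0_norm// ltr_pdivrMr// mulr_natr mulr2n ltrDl.
Qed.

(** By induction on [N]: the target is moved off [s N] and the radius capped by its distance to
    [s N], so the index found cannot be [N]. *)
Lemma dense_range_tail (v : X) (s : nat -> X) : v <> 0 -> dense (range s) ->
  forall N y e, 0 < e -> exists2 n, (N <= n)%N & d y (s n) < e.
Proof.
move=> v0 /dense_cim ds; elim=> [|N IH] y e e0.
  by have [_ [n _ <-] yn] := ds y e e0; exists n.
have e2 : 0 < e / 2 by rewrite divr_gt0.
have [y' y'N yy'] := cim_near_distinct v y (s N) (e / 2) v0 e2.
have [|n Nn] := IH y' (Num.min (e / 2) (d y' (s N))).
  by rewrite lt_min e2 cim_gt0.
rewrite lt_min => /andP[y'n1 y'n2]; exists n.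
  rewrite ltn_neqAle Nn andbT; apply/eqP => Nn'.
  by move: y'n2; rewrite -Nn' ltxx.
by apply: le_lt_trans (cim_triangle dP _ y' _) _; rewrite [e]splitr ltrD.
Qed.

Lemma combination_approx (q : nat -> K) :
  (forall z e : K, 0 < e -> exists n, `|z - q n| < e) ->
  forall (v : nat -> X) (c : nat -> K) n e, 0 < e ->
  exists i : nat -> nat,
    d (\sum_(0 <= k < n) c k *: v k) (\sum_(0 <= k < n) q (i k) *: v k) < e.
Proof.
move=> qP v c; elim=> [|n IH] e e0.
  by exists id; rewrite !big_geq// cim_xx.
have e2 : 0 < e / 2 by rewrite divr_gt0.
have [i iP] := IH _ e2.
have [r r0 rP] := scale_continuous_cim (v n) (c n) _ e2.
have [m mP] := qP (c n) r r0.
exists (fun k => if (k < n)%N then i k else m).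
rewrite !big_nat_recr//= ltnn; apply: cim_add_lt; last exact: rP.
by under [X in d _ X]eq_big_nat => k /andP[_ ->] do [].
Qed.

Lemma spans_separable (q : nat -> K) (x : nat -> nat -> X) (D : set nat) :
  (forall z e : K, 0 < e -> exists n, `|z - q n| < e) ->
  dense (\bigcup_(n in D) span_between (x n) 0 n) ->
  exists y : nat -> X, forall z e, 0 < e -> exists j, d z (y j) < e.
Proof.
move=> qP /dense_cim dD.
(* A row number and a finite list of indices into [q] code a combination, so countably many
   combinations are enough. *)
pose y (p : nat * seq nat) := \sum_(0 <= k < p.1.+1) q (nth 0%N p.2 k) *: x p.1 k.
exists (fun j => y (odflt (0%N, [::]) (unpickle j))) => z e e0.
have e2 : 0 < e / 2 by rewrite divr_gt0.
have [_ [n _ [c ->]] zw] := dD z _ e2.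
have [i iP] := combination_approx q qP (x n) c n.+1 _ e2.
exists (pickle (n, mkseq i n.+1)); rewrite pickleK/= /y/=.
have -> : \sum_(0 <= k < n.+1) q (nth 0%N (mkseq i n.+1) k) *: x n k =
          \sum_(0 <= k < n.+1) q (i k) *: x n k.
  by apply: eq_big_nat => k /andP[_ kn]; rewrite nth_mkseq.
by apply: le_lt_trans (cim_triangle dP _ _ _) _; rewrite [e]splitr; exact: ltrD zw iP.
Qed.

End InvariantMetric.

(** * Heads of the partial sums, and the cycle of implications *)

Lemma cvg_head (K : numFieldType) (X : tvsType K) (x : nat -> nat -> X)
    (l : nat -> X) (a : nat -> K) (k0 : nat) :
  (forall k, x n k @[n --> \oo] --> l k) ->
  \sum_(0 <= k < k0) a k *: x n k @[n --> \oo] --> \sum_(0 <= k < k0) a k *: l k.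
Proof.
move=> xl; elim: k0 => [|k0 IH].
  by under eq_fun do rewrite big_geq//; rewrite big_geq//; exact: cvg_cst.
under eq_fun do rewrite big_nat_recr//=; rewrite big_nat_recr//=.
apply: (@cvg_comp _ _ _
  (fun n => (\sum_(0 <= k < k0) a k *: x n k, a k0 *: x n k0))
  (fun p => p.1 + p.2)); last first.
  exact: (@add_continuous X (\sum_(0 <= k < k0) a k *: l k, a k0 *: l k0)).
apply: cvg_pair => //=.
apply: (@cvg_comp _ _ _ (fun n => (a k0 : K^o, x n k0))
  (fun p => p.1 *: p.2)); last first.
  exact: (@scale_continuous K X (a k0, l k0)).
apply: (@cvg_pair _ _ _ \oo (nbhs (a k0 : K^o)) (nbhs (l k0))).
  exact: cvg_cst.
exact: xl.
Qed.

Lemma span_between0 (K : numFieldType) (X : tvsType K) (v : nat -> X) m n :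
  span_between v m n 0.
Proof. by exists (fun=> 0); rewrite big1// => k _; rewrite scale0r. Qed.

Lemma partial_sum_split (K : numFieldType) (X : tvsType K)
    (x : nat -> nat -> X) (a : nat -> K) (k n : nat) : (k <= n)%N ->
  partial_sum x a n =
    \sum_(0 <= i < k) a i *: x n i + \sum_(k <= i < n.+1) a i *: x n i.
Proof. by move=> kn; rewrite /partial_sum (@big_cat_nat _ _ _ k)// leqW. Qed.

Theorem proposition2p13 (R : realType) (K : numFieldType)
  (HK : real_or_complex R K) (X : tvsType K) (HX : frechet_space R X)
  (x : nat -> nat -> X)
  (Hx : forall k : nat, exists l : X, x (k + j)%N k @[j --> \oo] --> l)
  (mu : nat -> nat) (Hmu : {homo mu : m n / (m < n)%N}) :
  [<-> universal mu x !=set0;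
       forall k0 : nat,
         dense (\bigcup_(n in range mu) span_between (x n) k0 n);
       forall n0 k0 : nat, (k0 <= n0)%N ->
         dense (\bigcup_(n in [set n | (n0 <= n)%N] `&` range mu)
                  span_between (x n) k0 n)].
Proof.
have [d dP] := HX.
(* Each column is reindexed by its row number, so that finitely many columns converge along the same
   index. *)
have /choice[l xl] : forall k, exists l : X, x n k @[n --> \oo] --> l.
  move=> k; have [l kl] := Hx k; exists l.
  move=> A /kl[N _ NA]; exists (k + N)%N => // n /= kNn.
  rewrite -(subnKC (leq_trans (leq_addr N k) kNn)); apply: NA => /=.
  by rewrite leq_subRL// (leq_trans (leq_addr N k)).
have mu_ge n : (n <= mu n)%N.
  by elim: n => // n IH; apply: leq_ltn_trans IH _; exact: Hmu.
tfae.
- move=> [a aU] k0; apply/(dense_cim dP) => y e e0.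
  (* In the zero space the only point is isolated; density then holds because every span contains
     0. *)
  have [[v v0]|Xtriv] := pselect (exists v : X, v <> 0); last first.
    have all0 (z : X) : z = 0 by apply: contrapT => z0; apply: Xtriv; exists z.
    exists 0; last by rewrite (all0 y) (cim_xx dP).
    by exists (mu 0%N); [exists 0%N|exact: span_between0].
  have e2 : 0 < e / 2 by rewrite divr_gt0.
  pose L := \sum_(0 <= k < k0) a k *: l k.
  have [N NP] := cvg_cim dP _ _ _ (cvg_head _ _ x l a k0 xl) e2.
  (* The target is [y + L] because the head of the partial sum is close to [L], which leaves the
     tail close to [y]. The bound [N] controls the head, and [k0] makes the split legitimate. *)
  have [n nN nP] := dense_range_tail dP v _ v0 aU (maxn N k0) (y + L) _ e2.
  move: nN; rewrite geq_max => /andP[nN nk].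
  exists (\sum_(k0 <= k < (mu n).+1) a k *: x (mu n) k).
    by exists (mu n); [exists n|exists a].
  rewrite -(cim_invariant dP _ _ L).
  apply: le_lt_trans (cim_triangle dP _ _ _) _; rewrite [e]splitr.
  apply: ltrD nP _; rewrite (partial_sum_split _ _ _ _ k0) ?(leq_trans nk)//.
  by rewrite [X in d _ X]addrC (cim_invariant dP) (cim_sym dP);
    exact: NP (leq_trans nN _).
- move=> H n0 k0 k0n0; apply/(dense_cim dP) => y e e0.
  have /(dense_cim dP)/(_ y e e0)[z [n nmu zn] yz] := H n0.
  exists z => //; have [n0n|nn0] := leqP n0 n.
    (* A combination starting at [n0] also starts at [k0], with zero coefficients below [n0]. *)
    exists n; first by split.
    case: zn => c ->; exists (fun k => if (k < n0)%N then 0 else c k).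
    rewrite (@big_cat_nat _ _ _ n0 k0)//= ?leqW//.
    rewrite [X in _ = X + _]big_nat_cond [X in _ = X + _]big1 ?add0r; last first.
      by move=> k /andP[/andP[_ ->] _]; rewrite scale0r.
    by apply: eq_big_nat => k /andP[n0k _]; rewrite ltnNge n0k.
  (* Here [n < n0], so the sum is empty and the point is 0, which also lies in the span of row
     [mu n0]. *)
  case: zn => c ->; rewrite big_geq//.
  by exists (mu n0); [split; [exact: mu_ge|exists n0]|exact: span_between0].
- move=> H; have [q qP] := scalars_separable R K HK.
  have [y yP] := spans_separable dP q x _ qP (H 0%N 0%N (leqnn 0)).
  (* Each [j] codes a target and a precision, so that every target is paired with every
     precision. *)
  pose err j : R := ((odflt (0, 0)%N (unpickle j)).2.+1%:R)^-1.
  pose tgt j := y (odflt (0, 0)%N (unpickle j)).1.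
  have [|a aP] := @prefix_glue K 0
      (fun j a => exists m, d (tgt j) (partial_sum x a (mu m)) < err j).
    move=> j k a.
    have e2 : 0 < err j / 2 by rewrite divr_gt0// invr_gt0.
    pose L := \sum_(0 <= i < k) a i *: l i.
    have [N NP] := cvg_cim dP _ _ _ (cvg_head _ _ x l a k xl) e2.
    have /(dense_cim dP)/(_ (tgt j - L) _ e2)[_ [n [/= nN [m _ mn]] [c ->]] nP] :=
      H (maxn N k) k (leq_maxr _ _).
    move: nN; rewrite geq_max => /andP[nN nk].
    (* The new block fills the indices from [k] to [n]. The partial sum at row [n] reads nothing
       beyond [n], so a prefix of length [n.+1] fixes it for good. *)
    exists (fun i => if (i < k)%N then a i else c i), n.+1; split => //.
      by move=> i ->.
    move=> b bP; exists m; rewrite mn (partial_sum_split _ _ _ _ k)//.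
    rewrite -(subrK L (tgt j)) addrC; apply: (cim_add_lt dP).
      rewrite (_ : \sum_(_ <= _ < _) _ = \sum_(0 <= i < k) a i *: x n i).
        exact: NP.
      apply: eq_big_nat => i /andP[_ ik].
      by rewrite bP ?ik// (leq_trans ik)// leqW.
    rewrite (_ : \sum_(_ <= _ < _) _ = \sum_(k <= i < n.+1) c i *: x n i)//.
    by apply: eq_big_nat => i /andP[ki ik]; rewrite bP// ltnNge ki.
  exists a; apply/(dense_cim dP) => z e e0.
  have e2 : 0 < e / 2 by rewrite divr_gt0.
  have [j jP] := yP z _ e2.
  have [p pP] : exists p : nat, p.+1%:R^-1 < e / 2.
    by have [p] := ltr_add_invr e2; rewrite add0r; exists p.
  have [m] := aP (pickle (j, p)); rewrite /tgt /err pickleK/= => mP.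
  exists (partial_sum x a (mu m)); first by exists m.
  apply: le_lt_trans (cim_triangle dP _ _ _) _; rewrite [e]splitr.
  by apply: ltrD jP _; apply: lt_trans pP.
Qed.
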